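(* Let $n\ge1$ be an integer and let $f:\mathbf{B}_n\to(-1,1)$ be a pluriharmonic function. Then $$|\nabla f(z)|\le \frac{4}{\pi}\,\frac{1-|f(z)|^2}{1-|z|^2}\qquad\text{for all } z\in \mathbf{B}_n .$$ The inequality is sharp: for every $n\ge 1$, the constant $\frac{4}{\pi}$ cannot be replaced by any smaller constant.
   Context: $\mathbf{B}_n=\{z\in\mathbf{C}^n:|z|<1\}$ is the open unit ball of $\mathbf{C}^n$ with respect to the Euclidean norm $|\cdot|$. A real-valued function on $\mathbf{B}_n$ is pluriharmonic if it is the real part of a holomorphic function on $\mathbf{B}_n$. Writing $z=(z_1,\dots,z_n)$ with $z_k=x_k+iy_k$, $\nabla f=(f_{x_1},f_{y_1},\dots,f_{x_n},f_{y_n})$ is the real gradient of $f$, and $|\nabla f|=\sqrt{\sum_{k=1}^n f_{x_k}^2+\sum_{k=1}^n f_{y_k}^2}$ is its Euclidean norm. *)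

(* Defs.v *)
(* For an arbitrary R : realType, the complex numbers are R[i] seen as the
   regular module R[i]^o, which carries the normed space structure over itself
   (the library puts none on R[i]); C^n is 'rV[R[i]^o]_n. *)
From HB Require Import structures.
From mathcomp Require Import all_boot all_order all_algebra complex.
From mathcomp Require Import all_classical all_reals all_analysis.

Set Implicit Arguments.
Unset Strict Implicit.
Unset Printing Implicit Defensive.

Import Order.TTheory GRing.Theory Num.Theory.
Import numFieldNormedType.Exports.
Local Open Scope classical_set_scope.
Local Open Scope ring_scope.
Local Open Scope complex_scope.

(* The norm of 'rV[R[i]^o]_n in the library is the sup norm (with values in R[i]^o),
   hence this separate Euclidean norm; both induce the same topology. *)
Definition enorm (R : realType) (n : nat) (z : 'rV[R[i]^o]_n) : R :=
  Num.sqrt (\sum_(k < n) (complex.Re (z 0 k) ^+ 2 + complex.Im (z 0 k) ^+ 2)).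

Definition unit_ball (R : realType) (n : nat) : set 'rV[R[i]^o]_n :=
  [set z | enorm z < 1].

(* The normed spaces 'rV[R[i]^o]_n and R[i]^o are over the complex field, so that
   [differentiable] is complex (Frechet) differentiability. *)
Definition holomorphic_on (R : realType) (n : nat) (U : set 'rV[R[i]^o]_n)
    (F : 'rV[R[i]^o]_n -> R[i]^o) : Prop :=
  forall z, U z -> differentiable F z.

(* Functions on the ball are represented by total functions on C^n, whose values
   outside of the ball are irrelevant. *)
Definition pluriharmonic_on_ball (R : realType) (n : nat)
    (f : 'rV[R[i]^o]_n -> R) : Prop :=
  exists F : 'rV[R[i]^o]_n -> R[i]^o,
    holomorphic_on (@unit_ball R n) F /\
    forall z, unit_ball z -> f z = complex.Re (F z).

(* With z_k = x_k + i y_k, these are the real partial derivatives of f with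
   respect to x_k and y_k. *)
Definition partial_x (R : realType) (n : nat) (f : 'rV[R[i]^o]_n -> R)
    (k : 'I_n) (z : 'rV[R[i]^o]_n) : R :=
  derive1 (fun t : R => f (z + (t +i* 0) *: delta_mx 0 k)) 0.

Definition partial_y (R : realType) (n : nat) (f : 'rV[R[i]^o]_n -> R)
    (k : 'I_n) (z : 'rV[R[i]^o]_n) : R :=
  derive1 (fun t : R => f (z + (0 +i* t) *: delta_mx 0 k)) 0.

Definition grad_norm (R : realType) (n : nat) (f : 'rV[R[i]^o]_n -> R)
    (z : 'rV[R[i]^o]_n) : R :=
  Num.sqrt (\sum_(k < n) partial_x f k z ^+ 2 + \sum_(k < n) partial_y f k z ^+ 2).

(* Main.v *)
(* Composing with a Moebius parametrization of a complex line slice of the ball,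
   and choosing the direction of the gradient, reduces the bound to a holomorphic
   F on the unit disc with |Re F| < 1, at the origin. With a = Re F(0) and f = Re F
   on the circle of radius r, the mean value property gives
     \int_0^{2 pi} (f(t) - a) (cos t - k) dt = pi r Re F'(0),
   and (f - a) (cos t - k) <= |cos t - k| - a (cos t - k). The choice
   k = cos (pi (1 + a) / 2) bounds the integral by 4 sin (pi (1 + a) / 2), which is
   at most 4 (1 - a^2) by concavity of the sine.

   Complex differentiability alone being assumed, the mean value property is
   obtained from Goursat's lemma on the rectangles of the plane of w = log z; the
   line integrals in it are increments of primitives. For the sharpness, the
   extremal function is Re (4 / pi * arctan z_1) at the origin. *)
Require Import Defs.
From HB Require Import structures.
From mathcomp Require Import all_boot all_order all_algebra complex.
From mathcomp Require Import all_classical all_reals all_analysis.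
From mathcomp Require Import ring lra.

Set Implicit Arguments.
Unset Strict Implicit.
Unset Printing Implicit Defensive.

Import Order.TTheory GRing.Theory Num.Theory.
Import numFieldNormedType.Exports.
Local Open Scope classical_set_scope.
Local Open Scope ring_scope.
Local Open Scope complex_scope.
Local Notation normc := Normc.normc.

(** * Complex derivatives and the exponential *)

Lemma normC_normc (R : realType) (z : R[i]) : `|z| = (normc z)%:C.
Proof. by []. Qed.

Lemma normc_ge0 (R : realType) (z : R[i]) : 0 <= normc z.
Proof. by rewrite -lecR -normC_normc normr_ge0. Qed.

(** Multiplying the difference quotient out removes the division and the excluded point [z = w]. The
    field [K] is instantiated both with the real and with the complex numbers. *)
Lemma is_derive_epsP (K : numFieldType) (h : K -> K) (w D : K) :
  is_derive w 1 h D <->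
  forall e : K, 0 < e -> exists2 d : K, 0 < d & forall z : K,
    `|z - w| < d -> `|h z - h w - D * (z - w)| <= e * `|z - w|.
Proof.
have -> : is_derive w 1 h D <->
    (fun k : K => k^-1 *: (h (k *: 1 + w) - h w)) @ (0 : K)^' --> D.
  split=> [[hd <-] //|hD].
  by apply: DeriveDef; [apply/cvg_ex; exists D|apply/cvg_lim].
rewrite cvgrPdist_le; split=> [hD e e0|hD e e0].
  have /hD := e0.
  rewrite near_withinE => /nbhs_ballP[d /= d0 hd].
  exists d => // z; have [->|zw zd] := eqVneq z w.
    by rewrite !subrr mulr0 subrr normr0 mulr0.
  have zw0 : z - w != 0 by rewrite subr_eq0.
  have := hd (z - w); rewrite -ball_normE /= sub0r normrN => /(_ zd zw0).
  rewrite [in h _]/GRing.scale/= mulr1 subrK => le1.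
  have -> : h z - h w - D * (z - w) =
            - (D - (z - w)^-1 *: (h z - h w)) * (z - w).
    by rewrite opprB mulrBl /GRing.scale/= mulrAC mulVf// mul1r.
  by rewrite normrM normrN ler_wpM2r.
have [d d0 hd] := hD e e0.
rewrite near_withinE; apply/nbhs_ballP; exists d => //=.
move=> k; rewrite -ball_normE /= sub0r normrN => kd k0.
have := hd (k *: 1 + w); rewrite /GRing.scale/= mulr1 addrK => /(_ kd) le1.
rewrite -(ler_pM2r (_ : 0 < `|k|)) ?normr_gt0//; apply: le_trans le1.
rewrite -normrM -normrN; rewrite le_eqVlt; apply/orP; left; apply/eqP; congr `|_|.
by rewrite -mulNr opprB mulrBl mulrAC mulVf// mul1r.
Qed.

Lemma is_derive_comp (K : numFieldType) (f g : K -> K) (x a b : K) :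
  is_derive (g x) 1 f a -> is_derive x 1 g b -> is_derive x 1 (f \o g) (b * a).
Proof.
move=> [/derivable1_diffP df <-] [/derivable1_diffP dg <-].
apply: DeriveDef; first exact/derivable1_diffP/differentiable_comp.
rewrite (deriveE _ (differentiable_comp dg df)) diff_comp//= !deriveE//.
exact: etrans (congr1 _ (esym (mulr1 _))) (linearZ _ _).
Qed.

Lemma is_derive_affine (K : numFieldType) (a b x : K) :
  is_derive x 1 (fun y => a + b * y) b.
Proof.
apply/is_derive_epsP => e e0; exists 1 => // z _.
rewrite (_ : _ - _ - _ = 0); last by ring.
by rewrite normr0 mulr_ge0// ltW.
Qed.

(** A positive element of [R[i]] has zero imaginary part, so [e] and [d] may range over [R]. *)
Lemma is_deriveC_epsP (R : realType) (h : R[i]^o -> R[i]^o) (w D : R[i]^o) :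
  is_derive w 1 h D <->
  forall e : R, 0 < e -> exists2 d : R, 0 < d & forall z : R[i]^o,
    normc (z - w) < d ->
    normc (h z - h w - D * (z - w)) <= e * normc (z - w).
Proof.
have gt0C (e : R[i]) : 0 < e -> exists2 d : R, e = d%:C & 0 < d.
  by case: e => a b; rewrite ltcE/= => /andP[/eqP-> ?]; exists a.
rewrite is_derive_epsP; split=> hD e.
  rewrite -ltcR => /hD[_ /gt0C[d -> d0] hd]; exists d => // z zd.
  by have := hd z; rewrite !normC_normc ltcR -rmorphM lecR; exact.
move=> /gt0C[{}e -> /hD[d d0 hd]]; exists d%:C; first by rewrite ltcR.
by move=> z; rewrite !normC_normc ltcR -rmorphM lecR; exact: hd.
Qed.

Lemma normc_Re (R : realType) (z : R[i]) : `|complex.Re z| <= normc z.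
Proof. by rewrite -lecR -normC_normc normc_ge_Re. Qed.

Lemma normc_Im (R : realType) (z : R[i]) : `|complex.Im z| <= normc z.
Proof.
by case: z => a b /=; rewrite -sqrtr_sqr ler_wsqrtr// lerDr sqr_ge0.
Qed.

Lemma normc_leD (R : realType) (z : R[i]) :
  normc z <= `|complex.Re z| + `|complex.Im z|.
Proof.
case: z => a b /=; rewrite -[leRHS]ger0_norm ?addr_ge0// -[leRHS]sqrtr_sqr.
rewrite ler_wsqrtr// sqrrD !real_normK ?num_real// addrAC lerDl.
by rewrite mulrn_wge0 ?mulr_ge0.
Qed.

Definition cexp (R : realType) (z : R[i]^o) : R[i]^o :=
  (expR (complex.Re z) * cos (complex.Im z)) +i*
  (expR (complex.Re z) * sin (complex.Im z)).

Lemma cexpD (R : realType) (z w : R[i]^o) : cexp (z + w) = cexp z * cexp w.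
Proof.
case: z => a b; case: w => c d; rewrite /cexp /= expRD cosD sinD.
by apply/eqP; rewrite eq_complex /=; apply/andP; split; apply/eqP; ring.
Qed.

Lemma normc_cexp (R : realType) (z : R[i]^o) : normc (cexp z) = expR (complex.Re z).
Proof.
case: z => a b; rewrite /cexp /= !exprMn -mulrDr cos2Dsin2 mulr1 sqrtr_sqr.
by rewrite ger0_norm ?expR_ge0.
Qed.

Lemma is_derive_cexp0 (R : realType) : is_derive (0 : R[i]^o) 1 (@cexp R) 1.
Proof.
(* With [N] the modulus of [z], the real part of the error is at most [3 * e' * N] and the imaginary
   part at most [5 * e' * N], hence the factor [8]. *)
apply/is_deriveC_epsP => e e0; pose e' := Num.min 1 (e / 8).
have e'0 : 0 < e' by rewrite lt_min ltr01 divr_gt0.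
have e'1 : e' <= 1 by rewrite ge_min lexx.
have e'8 : 8 * e' <= e by rewrite mulrC -ler_pdivlMr// ge_min lexx orbT.
clearbody e'.
have dexp : is_derive (0 : R) 1 (@expR R) 1.
  by rewrite -[X in is_derive _ _ _ X](@expR0 R); exact: is_derive_expR.
have dcos : is_derive (0 : R) 1 (@cos R) 0.
  by have := is_derive_cos (0 : R); rewrite sin0 oppr0.
have dsin : is_derive (0 : R) 1 (@sin R) 1.
  by have := is_derive_sin (0 : R); rewrite cos0.
have [d1 d10 h1] := (is_derive_epsP _ _ _).1 dexp _ e'0.
have [d2 d20 h2] := (is_derive_epsP _ _ _).1 dcos _ e'0.
have [d3 d30 h3] := (is_derive_epsP _ _ _).1 dsin _ e'0.
exists (Num.min e' (Num.min d1 (Num.min d2 d3))) => [|z].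
  by rewrite !lt_min e'0 d10 d20 d30.
rewrite subr0 mul1r !lt_min => /and4P[ze' z1 z2 z3].
have := normc_Re z; have := normc_Im z; have := normc_leD (cexp z - cexp 0 - z).
case: z ze' z1 z2 z3 => x y; set N := normc _ => ze' z1 z2 z3.
rewrite /cexp /= expR0 cos0 sin0 mulr0 mul1r subr0 => hN yN xN.
have := h1 x; rewrite subr0 expR0 mul1r => /(_ (le_lt_trans xN z1)).
have := h2 y; rewrite subr0 cos0 mul0r subr0 => /(_ (le_lt_trans yN z2)).
have := h3 y; rewrite subr0 sin0 mul1r subr0 => /(_ (le_lt_trans yN z3)).
set X := expR x; set S := sin y; set K := cos y => hs hc hx.
have K1 : `|K| <= 1 by exact: cos_max.
have xe' : `|x| <= e' by apply: ltW; exact: le_lt_trans ze'.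
have x1 : `|x| <= 1 by exact: le_trans e'1.
have X1 : `|X - 1| <= 2 * `|x|.
  rewrite (_ : X - 1 = (X - 1 - x) + x); last by ring.
  rewrite (le_trans (ler_normD _ _))// mulr2n mulrDl mul1r lerD2r.
  by rewrite (le_trans hx)// ler_piMl.
have X3 : `|X| <= 3.
  rewrite (_ : X = (X - 1) + 1); last by ring.
  rewrite (le_trans (ler_normD _ _))// normr1.
  have := normr_ge0 x; lra.
have hRe : `|X * K - 1 - x| <= e' * `|x| + 2 * (e' * `|y|).
  rewrite (_ : X * K - 1 - x = (X - 1 - x) * K + (1 + x) * (K - 1)); last by ring.
  rewrite (le_trans (ler_normD _ _))// lerD// normrM.
    by rewrite -[leRHS]mulr1 ler_pM.
  by rewrite ler_pM// (le_trans (ler_normD _ _))// normr1; lra.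
have hIm : `|X * S - y| <= 3 * (e' * `|y|) + 2 * (e' * `|y|).
  rewrite (_ : X * S - y = X * (S - y) + (X - 1) * y); last by ring.
  rewrite (le_trans (ler_normD _ _))// lerD// normrM; first by rewrite ler_pM.
  by rewrite mulrA ler_wpM2r// (le_trans X1)// ler_pM2l.
have N0 : 0 <= N by exact: normc_ge0.
have := ler_wpM2r N0 e'8; have := ler_wpM2l (ltW e'0) xN.
have := ler_wpM2l (ltW e'0) yN.
move=> hy hx' hN'; apply: le_trans hN _ => /=.
rewrite -/X -/S -/K; lra.
Qed.

(** The functional equation moves the expansion at [0] to [w], up to the factor [cexp w]. *)
Global Instance is_derive_cexp (R : realType) (w : R[i]^o) :
  is_derive w 1 (@cexp R) (cexp w).
Proof.
apply/is_deriveC_epsP => e e0.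
have w0 : 0 < normc (cexp w) by rewrite normc_cexp expR_gt0.
have [d d0 hd] := (is_deriveC_epsP _ _ _).1 (is_derive_cexp0 R) _ (divr_gt0 e0 w0).
exists d => // z zd; have := hd (z - w); rewrite subr0 => /(_ zd).
have -> : cexp z - cexp w - cexp w * (z - w) =
    cexp w * (cexp (z - w) - cexp 0 - 1 * (z - w)).
  have -> : cexp z = cexp w * cexp (z - w) by rewrite -cexpD addrC subrK.
  have -> : cexp 0 = 1 :> R[i]^o.
    by rewrite /cexp/= expR0 cos0 sin0 mulr1 mulr0.
  by ring.
by rewrite Normc.normcM mulrAC ler_pdivlMr// mulrC.
Qed.

(** * Goursat's lemma *)

Lemma nested_intervals (R : realType) (u v : nat -> R) :
  (forall n, u n <= u n.+1) -> (forall n, v n.+1 <= v n) ->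
  (forall n, u n <= v n) -> exists x, forall n, u n <= x <= v n.
Proof.
move=> ui vd uv.
have um m n : (m <= n)%N -> u m <= u n.
  by move=> /subnK <-; elim: (n - m)%N => // k ih; rewrite addSn (le_trans ih).
have vm m n : (m <= n)%N -> v n <= v m.
  by move=> /subnK <-; elim: (n - m)%N => // k ih; rewrite addSn (le_trans _ ih).
have ub n : ubound (range u) (v n).
  move=> _ [m _ <-]; apply: le_trans (um _ _ (leq_maxl m n)) _.
  exact: le_trans (uv _) (vm _ _ (leq_maxr m n)).
exists (sup (range u)) => n; apply/andP; split.
  by apply: ub_le_sup; [exists (v 0%N)|exists n].
by apply: ge_sup => //; exists (u 0%N), 0%N.
Qed.

Lemma mean_value_le (R : realType) (f df : R -> R) (a b M : R) : a <= b ->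
  (forall x, a <= x <= b -> is_derive x 1 f (df x)) ->
  (forall x, a <= x <= b -> `|df x| <= M) -> `|f b - f a| <= M * (b - a).
Proof.
move=> ab hf hM.
have [||x xab ->] := @MVT_segment R f df a b ab.
- by move=> x; rewrite in_itv => /= /andP[? ?]; apply: hf; rewrite !ltW.
- apply: derivable_within_continuous => x; rewrite in_itv/= => xab.
  by have [] := hf x xab.
by rewrite normrM (ger0_norm (_ : 0 <= b - a)) ?subr_ge0// ler_wpM2r ?subr_ge0 ?hM.
Qed.

(* The integral of [P ds + Q dt] along the boundary of [[a, b] x [c, d]], where
   [U] is a primitive of [Q] in [t] and [V] is a primitive of [P] in [s]. *)
Definition rect_defect (R : realType) (U V : R -> R -> R) (a b c d : R) : R :=
  (U b d - U b c) - (U a d - U a c) - ((V b d - V a d) - (V b c - V a c)).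

(* [P ds + Q dt] is closed at [(s0, t0)]: [P] and [Q] are differentiable there,
   relatively to [D], and the derivative [A] of [Q] in [s] is that of [P] in
   [t]. *)
Definition closed_form_at (R : realType) (D : set (R * R)) (P Q : R -> R -> R)
    (s0 t0 : R) :=
  exists A B C : R, forall e : R, 0 < e -> exists2 r : R, 0 < r &
    forall s t, D (s, t) -> `|s - s0| < r -> `|t - t0| < r ->
    `|Q s t - Q s0 t0 - (A * (s - s0) + B * (t - t0))|
       <= e * (`|s - s0| + `|t - t0|) /\
    `|P s t - P s0 t0 - (C * (s - s0) + A * (t - t0))|
       <= e * (`|s - s0| + `|t - t0|).

Section goursat.
Context (R : realType) (D : set (R * R)) (P Q U V : R -> R -> R).
Hypothesis dU : forall s t, D (s, t) -> is_derive t 1 (U s) (Q s t).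
Hypothesis dV : forall s t, D (s, t) -> is_derive s 1 (V^~ t) (P s t).

Let W := rect_defect U V.

(** The affine approximation of [P ds + Q dt] at [(s0, t0)] is closed and has no defect; the mean
    value inequality bounds the contribution of the remainder on each of the four sides. *)
Lemma rect_defect_local (s0 t0 : R) : closed_form_at D P Q s0 t0 ->
  forall e, 0 < e -> exists2 r, 0 < r &
    forall a b c d, (forall s t, a <= s <= b -> c <= t <= d -> D (s, t)) ->
      a <= s0 <= b -> c <= t0 <= d -> b - a < r -> d - c < r ->
      `|W a b c d| <= e * ((b - a) + (d - c)) ^+ 2.
Proof.
move=> [A [B [C hABC]]] e e0.
have e20 : 0 < e / 2 by rewrite divr_gt0.
have [r r0 hr] := hABC _ e20; exists r => // a b c d sD sab tcd abr cdr.
have [/andP[sa sb] /andP[tc td]] := (sab, tcd).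
have ab : a <= b by exact: le_trans sb.
have cd : c <= d by exact: le_trans td.
have near s t : a <= s <= b -> c <= t <= d ->
    [/\ `|s - s0| < r, `|t - t0| < r &
      `|s - s0| + `|t - t0| <= (b - a) + (d - c)].
  move=> /andP[? ?] /andP[? ?].
  have ? : `|s - s0| <= b - a by rewrite ler_norml; lra.
  have ? : `|t - t0| <= d - c by rewrite ler_norml; lra.
  by split; [exact: le_lt_trans abr|exact: le_lt_trans cdr|exact: lerD].
(* Primitives of the affine approximations of [Q] in [t] and of [P] in [s]. Each contributes
   [A * (b - a) * (d - c)] to the defect, with opposite signs. *)
pose mU s t := (Q s0 t0 + A * (s - s0)) * t + B / 2 * (t - t0) ^+ 2.
pose mV s t := (P s0 t0 + A * (t - t0)) * s + C / 2 * (s - s0) ^+ 2.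
have hU s : a <= s <= b ->
    `|(U s d - mU s d) - (U s c - mU s c)| <=
    e / 2 * ((b - a) + (d - c)) * (d - c).
  move=> sI; apply: (@mean_value_le _ (fun t => U s t - mU s t)
    (fun t => Q s t - Q s0 t0 - (A * (s - s0) + B * (t - t0)))) => // t tI.
    have := dU (sD _ _ sI tI) => dUs; rewrite /mU.
    by apply: is_derive_eq; rewrite /GRing.scale/=; field.
  have [n1 n2 n3] := near _ _ sI tI.
  have [+ _] := hr _ _ (sD _ _ sI tI) n1 n2.
  by move=> h; apply: le_trans h _; rewrite ler_wpM2l// ltW.
have hV t : c <= t <= d ->
    `|(V b t - mV b t) - (V a t - mV a t)| <=
    e / 2 * ((b - a) + (d - c)) * (b - a).
  move=> tI; apply: (@mean_value_le _ (fun s => V s t - mV s t)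
    (fun s => P s t - P s0 t0 - (C * (s - s0) + A * (t - t0)))) => // s sI.
    have := dV (sD _ _ sI tI) => dVt; rewrite /mV.
    by apply: is_derive_eq; rewrite /GRing.scale/=; field.
  have [n1 n2 n3] := near _ _ sI tI.
  have [_] := hr _ _ (sD _ _ sI tI) n1 n2.
  by move=> h; apply: le_trans h _; rewrite ler_wpM2l// ltW.
have aI : a <= a <= b by rewrite lexx.
have bI : a <= b <= b by rewrite lexx andbT.
have cI : c <= c <= d by rewrite lexx.
have dI : c <= d <= d by rewrite lexx andbT.
move: (hU _ aI) (hU _ bI) (hV _ cI) (hV _ dI).
rewrite /W /rect_defect !ler_norml /mU /mV.
move=> /andP[? ?] /andP[? ?] /andP[? ?] /andP[? ?].
apply/andP; split; lra.
Qed.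

Lemma rect_defect_split (a b c d x y : R) :
  W a b c d = W a x c y + W x b c y + (W a x y d + W x b y d).
Proof. rewrite /W /rect_defect; ring. Qed.

(* Goursat's bisection argument: the form is only known to be closed pointwise,
   and nothing is assumed on the regularity of the derivatives of [P] and
   [Q]. *)
Lemma rect_defect_eq0 (a b c d : R) : a <= b -> c <= d ->
  (forall s t, a <= s <= b -> c <= t <= d -> D (s, t)) ->
  (forall s t, a <= s <= b -> c <= t <= d -> closed_form_at D P Q s t) ->
  W a b c d = 0.
Proof.
move=> ab cd sD hPQ.
pose h n : R := (b - a) / 2 ^+ n; pose k n : R := (d - c) / 2 ^+ n.
have h0 n : 0 <= h n by rewrite divr_ge0 ?exprn_ge0 ?subr_ge0.
have k0 n : 0 <= k n by rewrite divr_ge0 ?exprn_ge0 ?subr_ge0.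
have hS n : h n = h n.+1 + h n.+1.
  by rewrite /h exprS; field; rewrite expf_neq0.
have kS n : k n = k n.+1 + k n.+1.
  by rewrite /k exprS; field; rewrite expf_neq0.
pose w n (p : R * R) := W p.1 (p.1 + h n) p.2 (p.2 + k n).
have step (x : nat * (R * R)) : {q : R * R |
    [/\ `|w x.1 x.2| <= 4 * `|w x.1.+1 q|,
      x.2.1 <= q.1 <= x.2.1 + h x.1.+1 & x.2.2 <= q.2 <= x.2.2 + k x.1.+1]}.
  case: x => n [x y] /=; apply: cid.
  have hn := h0 n.+1; have kn := k0 n.+1.
  (* By [rect_defect_split] and the triangle inequality, one of the quarters carries at least a
     fourth of the defect; [q] is its lower left corner. *)
  have : exists q : R * R, `|w n (x, y)| <= 4 * `|w n.+1 q| /\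
      (q.1 = x \/ q.1 = x + h n.+1) /\ (q.2 = y \/ q.2 = y + k n.+1).
    apply: contrapT => /forallNP nq.
    have lt q : (q.1 = x \/ q.1 = x + h n.+1) ->
        (q.2 = y \/ q.2 = y + k n.+1) -> 4 * `|w n.+1 q| < `|w n (x, y)|.
      by move=> q1 q2; rewrite ltNge; apply/negP => le; apply: (nq q).
    have := lt (x, y) (or_introl erefl) (or_introl erefl).
    have := lt (x + h n.+1, y) (or_intror erefl) (or_introl erefl).
    have := lt (x, y + k n.+1) (or_introl erefl) (or_intror erefl).
    have := lt (x + h n.+1, y + k n.+1) (or_intror erefl) (or_intror erefl).
    have -> : w n (x, y) = (w n.+1 (x, y) + w n.+1 (x + h n.+1, y)) +
        (w n.+1 (x, y + k n.+1) + w n.+1 (x + h n.+1, y + k n.+1)).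
      rewrite /w /= (hS n) (kS n) !(addrA x) !(addrA y).
      exact: rect_defect_split.
    move: (w n.+1 _) (w n.+1 _) (w n.+1 _) (w n.+1 _) => w3 w2 w1 w4.
    have := ler_normD (w1 + w2) (w3 + w4).
    have := ler_normD w1 w2; have := ler_normD w3 w4; lra.
  move=> [q [? [q1 q2]]]; exists q; split => //.
    by case: q1 => ->; lra.
  by case: q2 => ->; lra.
pose fix p n : R * R := if n is m.+1 then sval (step (m, p m)) else (a, c).
have pP n : [/\ `|w n (p n)| <= 4 * `|w n.+1 (p n.+1)|,
    (p n).1 <= (p n.+1).1 <= (p n).1 + h n.+1 &
    (p n).2 <= (p n.+1).2 <= (p n).2 + k n.+1].
  by have := svalP (step (n, p n)).
have [s0 s0P] : exists x, forall n, (p n).1 <= x <= (p n).1 + h n.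
  apply: nested_intervals => n; last by rewrite lerDl.
    by have [_ /andP[]] := pP n.
  have [_ /andP[_ le1] _] := pP n.
  by rewrite [leRHS](_ : _ = (p n).1 + h n.+1 + h n.+1) ?lerD2r// (hS n) addrA.
have [t0 t0P] : exists x, forall n, (p n).2 <= x <= (p n).2 + k n.
  apply: nested_intervals => n; last by rewrite lerDl.
    by have [_ _ /andP[]] := pP n.
  have [_ _ /andP[_ le1]] := pP n.
  by rewrite [leRHS](_ : _ = (p n).2 + k n.+1 + k n.+1) ?lerD2r// (kS n) addrA.
have pI n : a <= (p n).1 /\ (p n).1 + h n <= b /\ c <= (p n).2 /\ (p n).2 + k n <= d.
  elim: n => [|n [i1 [i2 [i3 i4]]]]; first by rewrite /= /h /k !divr1; lra.
  have [_ /andP[? ?] /andP[? ?]] := pP n; rewrite (hS n) in i2.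
  by rewrite (kS n) in i4; lra.
have wP n : `|W a b c d| <= 4 ^+ n * `|w n (p n)|.
  elim: n => [|n ih]; first by rewrite mul1r /w /= /h /k !divr1 !subrKC.
  apply: (le_trans ih); rewrite exprSr -mulrA ler_wpM2l ?exprn_ge0//.
  by have [] := pP n.
have s0I : a <= s0 <= b by have := s0P 0%N; rewrite /= /h divr1 subrKC.
have t0I : c <= t0 <= d by have := t0P 0%N; rewrite /= /k divr1 subrKC.
apply/eqP; rewrite -normr_le0; apply/ler_addgt0Pl => e e0; rewrite addr0.
pose L := (b - a) + (d - c).
have L0 : 0 <= L by rewrite addr_ge0 ?subr_ge0.
(* After [n] bisections the factor [4 ^+ n] cancels against the square of [L / 2 ^+ n], which leaves
   [e * (L ^+ 2 / (1 + L ^+ 2))]. Adding [1] covers the degenerate case [L = 0]. *)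
have e'0 : 0 < e / (1 + L ^+ 2) by rewrite divr_gt0// ltr_pwDl// sqr_ge0.
have [r r0 hr] := rect_defect_local (hPQ _ _ s0I t0I) e'0.
pose n := Num.bound (L / r).
have hkn : h n + k n < r.
  rewrite /h /k -mulrDl -/L ltr_pdivrMr ?exprn_gt0// mulrC -ltr_pdivrMr//.
  apply: lt_trans (archi_boundP _) _; first by rewrite divr_ge0// ltW.
  by rewrite -natrX ltr_nat ltn_expl.
apply: le_trans (wP n) _.
have [i1 [i2 [i3 i4]]] := pI n.
have hn := h0 n; have kn := k0 n.
have := hr (p n).1 ((p n).1 + h n) (p n).2 ((p n).2 + k n).
have subK (x y : R) : x + y - x = y by rewrite addrC addKr.
rewrite !subK => /(_ _ (s0P n) (t0P n)) hW.
have -> : `|w n (p n)| = `|W (p n).1 ((p n).1 + h n) (p n).2 ((p n).2 + k n)| by [].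
apply: le_trans (ler_wpM2l _ (hW _ _ _)) _; rewrite ?exprn_ge0//; [|lra|lra|].
  by move=> s t /andP[? ?] /andP[? ?]; apply: sD; lra.
have L1 : 0 < 1 + L ^+ 2 by rewrite ltr_pwDl// sqr_ge0.
have p4 : (4 : R) ^+ n = (2 ^+ n) ^+ 2.
  by rewrite -exprM mulnC exprM; congr (_ ^+ n); ring.
rewrite /h /k -mulrDl -/L p4.
have -> : (2 ^+ n) ^+ 2 * (e / (1 + L ^+ 2) * (L / 2 ^+ n) ^+ 2) =
    e * (L ^+ 2 / (1 + L ^+ 2)).
  by field; rewrite gt_eqF//= expf_neq0.
by rewrite ler_piMr ?(ltW e0)// ler_pdivrMr// mul1r lerDr.
Qed.

End goursat.

(** Composing [g] with the projection [c] onto [[a, b]] makes it continuous everywhere; working on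
    the larger interval from [a - 1] to [b + 1] yields two-sided derivatives at the endpoints
    too. *)
Lemma primitive_exists (R : realType) (g : R -> R) (a b : R) :
  (forall x, a <= x <= b -> {for x, continuous g}) ->
  exists G : R -> R, forall x, a <= x <= b -> is_derive x 1 G (g x).
Proof.
move=> gc; have [ba|ab] := ltP b a.
  by exists g => x /andP[ax xb]; have := lt_le_trans ba (le_trans ax xb); rewrite ltxx.
pose c x := Num.max a (Num.min x b).
have cI x : a <= c x <= b by rewrite le_max lexx ge_max ab ge_min lexx orbT.
have cc : continuous c.
  move=> x; apply: (@continuous_max R R (cst a) (fun y : R => Num.min y b)).
    exact: cst_continuous.
  apply: (@continuous_min R R id (cst b)); first by move=> ?.
  exact: cst_continuous.
have cK x : a <= x <= b -> c x = x.
  by move=> /andP[ax xb]; rewrite /c min_l// max_r.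
have gcc : continuous (g \o c).
  by move=> x; apply: continuous_comp; [exact: cc|exact: gc].
exists (fun x => \int[lebesgue_measure]_(t in `[a - 1, x]) (g \o c) t)%R => x xI.
have /andP[ax xb] := xI.
have xb1 : x < b + 1 by rewrite (le_lt_trans xb)// ltrDl.
have [|||df dE] := @continuous_FTC1_closed R (g \o c) (a - 1) x (b + 1) xb1.
- apply: continuous_compact_integrable; first exact: segment_compact.
  exact: continuous_subspaceT.
- by rewrite (lt_le_trans _ ax)// ltrBlDr ltrDl.
- exact: gcc.
by apply: DeriveDef => //; rewrite -derive1E dE /= cK.
Qed.

(** * The mean value property on circles *)

Lemma lipschitz_continuous_at (R : realType) (g : R -> R) (x K r : R) : 0 < r ->
  (forall y, `|y - x| < r -> `|g y - g x| <= K * `|y - x|) ->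
  {for x, continuous g}.
Proof.
move=> r0 hg; apply/cvgrPdist_le => e e0; apply/nbhs_ballP.
have K0 : 0 < `|K| + 1 by rewrite ltr_pwDr.
exists (Num.min r (e / (`|K| + 1))); first by rewrite /= lt_min r0 divr_gt0.
move=> y; rewrite /ball /= distrC lt_min => /andP[yr ye].
rewrite distrC (le_trans (hg _ yr))//.
apply: (@le_trans _ _ ((`|K| + 1) * `|y - x|)).
  by rewrite ler_wpM2r// (le_trans (ler_norm _))// lerDl.
by rewrite mulrC -ler_pdivlMr// ltW.
Qed.

Section circle_mean.
Context (R : realType) (h : R[i]^o -> R[i]^o).
Hypothesis dh : forall z, 0 < normc z < 1 -> derivable h z 1.

(** With [w = s + i t] and [H = h \o cexp], the form [P ds + Q dt] is the imaginary part of [H dw];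
    along a vertical segment it reduces to the real part of [H] times [dt]. *)
Let Q s t := complex.Re (h (cexp (s +i* t))).
Let P s t := complex.Im (h (cexp (s +i* t))).

Let dH (w : R[i]^o) : complex.Re w < 0 -> exists D, is_derive w 1 (h \o @cexp R) D.
Proof.
move=> w0; exists (cexp w * 'D_1 h (cexp w)).
apply: (@is_derive_comp _ h (@cexp R) w _ _ _ (is_derive_cexp w)).
by apply/derivableP/dh; rewrite normc_cexp expR_gt0 expR_lt1.
Qed.

(** These are the Cauchy-Riemann equations: if [h \o cexp] has derivative [A + i B], then
    [dQ = A ds - B dt] and [dP = B ds + A dt]. *)
Let closedH (D : set (R * R)) s t : s < 0 -> closed_form_at D P Q s t.
Proof.
move=> s0; have [[A B] /is_deriveC_epsP hD] := dH (w := s +i* t) s0.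
exists A, (- B), B => e e0; have e20 : 0 < e / 2 by rewrite divr_gt0.
have [d d0 {}hD] := hD e e0; exists (d / 2); first by rewrite divr_gt0.
move=> s' t' _ s's t't; have := hD (s' +i* t').
have nz : normc ((s' +i* t' : R[i]^o) - (s +i* t)) <= `|s' - s| + `|t' - t|.
  exact: normc_leD.
have /[swap]/[apply] : normc ((s' +i* t' : R[i]^o) - (s +i* t)) < d.
  by rewrite (le_lt_trans nz)// (_ : d = d / 2 + d / 2) ?ltrD//; field.
set X := (X in normc X) => hX; have := normc_Re X; have := normc_Im X.
have {}hX : normc X <= e * (`|s' - s| + `|t' - t|).
  by rewrite (le_trans hX)// ler_wpM2l// ltW.
have -> : complex.Re X = Q s' t' - Q s t - (A * (s' - s) + - B * (t' - t)).
  rewrite /X /Q /=; case: (h _) => ? ?; case: (h _) => ? ? /=; ring.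
have -> : complex.Im X = P s' t' - P s t - (B * (s' - s) + A * (t' - t)).
  rewrite /X /P /=; case: (h _) => ? ?; case: (h _) => ? ? /=; ring.
by move=> h1 h2; split; exact: le_trans hX.
Qed.

Let contQ s t : s < 0 -> {for t, continuous (Q s)}.
Proof.
move=> s0; have [A [B [C hAB]]] := @closedH setT s t s0.
have [d d0 hd] := hAB 1 ltr01.
apply: (@lipschitz_continuous_at _ _ _ (1 + `|B|) d) => // t' tt'.
have [|+ _] := hd s t' I _ tt'; first by rewrite subrr normr0.
rewrite !subrr normr0 mulr0 !add0r mul1r => h1.
rewrite mulrDl mul1r -normrM; set X := Q _ _ - _ in h1 *.
by rewrite (_ : X = X - B * (t' - t) + B * (t' - t)) ?(le_trans (ler_normD _ _))//
  ?lerD2r// subrK.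
Qed.

Let contP s t : s < 0 -> {for s, continuous (P^~ t)}.
Proof.
move=> s0; have [A [B [C hAB]]] := @closedH setT s t s0.
have [d d0 hd] := hAB 1 ltr01.
apply: (@lipschitz_continuous_at _ _ _ (1 + `|C|) d) => // s' ss'.
have [|_] := hd s' t I ss'; first by rewrite subrr normr0.
rewrite !subrr normr0 mulr0 !addr0 mul1r => h1.
rewrite mulrDl mul1r -normrM; set X := P _ _ - _ in h1 *.
by rewrite (_ : X = X - C * (s' - s) + C * (s' - s)) ?(le_trans (ler_normD _ _))//
  ?lerD2r// subrK.
Qed.

(* [U s] is a primitive of [Q s]. In the variable [w = log z] the circles around
   [0] become vertical segments, so that by Goursat's lemma the increment of
   [U s] does not depend on [s]; its value is found by letting [s] tend to
   [-oo]. *)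
Lemma circle_mean (r : R) (l : R[i]^o) : 0 < r < 1 ->
  h z @[z --> (0 : R[i]^o)^'] --> l ->
  exists2 G : R -> R,
    (forall t, 0 <= t <= 2 * pi ->
      is_derive t 1 G (complex.Re (h ((r * cos t) +i* (r * sin t))))) &
    G (2 * pi) - G 0 = 2 * pi * complex.Re l.
Proof.
move=> /andP[r0 r1] hl.
have {}hl e : 0 < e -> exists2 d, 0 < d &
     forall z, 0 < normc z < d -> normc (h z - l) <= e.
  rewrite -ltcR; move/cvgrPdist_le : hl => /[apply]; rewrite near_withinE.
  move=> /nbhs_ballP[[d d'] /=]; rewrite ltcE /= => /andP[/eqP-> d0] hd.
  exists d => // z /andP[z0 zd]; have := hd z; rewrite -ball_normE /= sub0r.
  rewrite distrC normrN !normC_normc ltcR lecR; apply => //.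
  by apply: contraTneq z0 => ->; rewrite Normc.normc0 ltxx.
have pi0 : (0 : R) <= 2 * pi by rewrite mulr_ge0 ?pi_ge0.
pose b : R := ln r.
have b0 : b < 0 by rewrite ln_lt0// r0.
have /choice[U hU] s : exists G : R -> R, s < 0 ->
    forall t, 0 <= t <= 2 * pi -> is_derive t 1 G (Q s t).
  have [s0|s0] := ltP s 0; last by exists id.
  have [t _|G hG] := @primitive_exists R (Q s) 0 (2 * pi); first exact: contQ.
  by exists G.
exists (U b).
  by move=> t tI; have := hU _ b0 _ tI; rewrite /Q /cexp /= lnK.
have Ua a : a <= b -> U b (2 * pi) - U b 0 = U a (2 * pi) - U a 0.
  move=> ab.
  (* [V] attaches a primitive to a function and not to a parameter [t]. As [P] is periodic in [t],
     the two horizontal sides receive the same primitive and cancel. *)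
  have /choice[V hV] (g : R -> R) : exists G : R -> R,
      (forall s, a <= s <= b -> {for s, continuous g}) ->
      forall s, a <= s <= b -> is_derive s 1 G (g s).
    have [gc|gc] := pselect (forall s, a <= s <= b -> {for s, continuous g}).
      by have [G hG] := primitive_exists gc; exists G.
    by exists id.
  have lt0 s : a <= s <= b -> s < 0 by move=> /andP[_ sb]; exact: le_lt_trans b0.
  pose D := [set st : R * R | a <= st.1 <= b /\ 0 <= st.2 <= 2 * pi].
  have : rect_defect U (fun s t => V (P^~ t) s) a b 0 (2 * pi) = 0.
    apply: (@rect_defect_eq0 R D P Q) => //.
    - by move=> s t [/= sI tI]; apply: hU => //; exact: lt0.
    - move=> s t [/= sI tI]; apply: hV => // s' s'I; apply: contP; exact: lt0.
    - by move=> s t sI tI; apply: closedH; exact: lt0.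
  rewrite /rect_defect; have -> : V (P^~ (2 * pi)) = V (P^~ 0).
    congr V; apply/funext => s; rewrite /P /cexp /=.
    by rewrite mulr_natl cos2pi sin2pi cos0 sin0.
  lra.
apply/eqP; rewrite -subr_eq0 -normr_le0; apply/ler_addgt0Pl => e e0; rewrite addr0.
have e'0 : 0 < e / (2 * pi) by rewrite divr_gt0// mulr_gt0 ?pi_gt0.
have [d d0 hd] := hl _ e'0.
(* This gives [expR a < d], so on the circle of radius [expR a] the values of [h] are within
   [e / (2 * pi)] of [l]. *)
pose a := Num.min b (ln d - 1).
have ab : a <= b by rewrite ge_min lexx.
rewrite (Ua a ab).
have -> : U a (2 * pi) - U a 0 - 2 * pi * complex.Re l =
   (U a (2 * pi) - complex.Re l * (2 * pi)) - (U a 0 - complex.Re l * 0).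
  by ring.
apply: (@le_trans _ _ (e / (2 * pi) * (2 * pi - 0))); last first.
  by rewrite subr0 divfK// mulf_neq0// gt_eqF// pi_gt0.
have a0 : a < 0 by exact: le_lt_trans b0.
apply: (@mean_value_le _ (fun t => U a t - complex.Re l * t)
  (fun t => Q a t - complex.Re l)) => // t tI.
  have := hU a a0 t tI => dUa.
  by apply: is_derive_eq; rewrite /GRing.scale/=; ring.
have := normc_Re (h (cexp (a +i* t)) - l); rewrite raddfB.
move=> /le_trans; apply; apply: hd; rewrite normc_cexp /= expR_gt0/=.
rewrite -[ltRHS]lnK// ltr_expR.
rewrite (le_lt_trans (_ : a <= ln d - 1))// ?ge_min ?lexx ?orbT//.
by rewrite ltrBlDr ltrDl.
Qed.

End circle_mean.

(** * Functions from the disc to the strip *)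

Lemma le_increment (R : realType) (f g df dg : R -> R) (a b : R) : a <= b ->
  (forall x, a <= x <= b -> is_derive x 1 f (df x)) ->
  (forall x, a <= x <= b -> is_derive x 1 g (dg x)) ->
  (forall x, a <= x <= b -> df x <= dg x) -> f b - f a <= g b - g a.
Proof.
move=> ab hf hg fg.
have hgf x : a <= x <= b -> is_derive x 1 (fun y => g y - f y) (dg x - df x).
  by move=> xab; have := hf x xab; have := hg x xab => ? ?; exact: is_deriveB.
suff : 0 <= (g b - f b) - (g a - f a) by lra.
have [||x xab ->] :=
  @MVT_segment R (fun y => g y - f y) (fun x => dg x - df x) a b ab.
- by move=> x; rewrite in_itv => /= /andP[? ?]; apply: hgf; rewrite !ltW.
- apply: derivable_within_continuous => x; rewrite in_itv/= => xab.
  by have [] := hgf x xab.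
by rewrite mulr_ge0 ?subr_ge0// fg.
Qed.

(** Concavity of the sine on [[0, pi / 4]]: the graph lies above its chord. *)
Lemma chord_sin_le (R : realType) (y : R) : 0 <= y <= 1 ->
  y * sin (pi / 4) <= sin (pi / 4 * y).
Proof.
move=> /andP[y0 y1]; have [->|yn0] := eqVneq y 0; first by rewrite mul0r mulr0 sin0.
have [->|yn1] := eqVneq y 1; first by rewrite mul1r mulr1.
have {yn0}y0 : 0 < y by rewrite lt_def yn0.
have {yn1}y1 : y < 1 by rewrite lt_def eq_sym yn1.
pose p (x : R) := sin (pi / 4 * x) - x * sin (pi / 4).
pose dp (x : R) := pi / 4 * cos (pi / 4 * x) - sin (pi / 4).
have hp (x : R) : is_derive x 1 p (dp x).
  rewrite /p /dp.
  have h1 : is_derive x 1 (fun x : R => pi / 4 * x) (pi / 4).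
    by apply: is_derive_eq; rewrite /GRing.scale/= mulr1.
  have h2 : is_derive x 1 (fun x : R => sin (pi / 4 * x)) (pi / 4 * cos (pi / 4 * x)).
    rewrite [X in is_derive _ _ _ X]mulrC.
    exact: (@is_derive1_comp R sin (fun x : R => pi / 4 * x) x _ _
      (is_derive_sin _) h1).
  by apply: is_derive_eq; rewrite /GRing.scale/=; ring.
have pc (a b : R) : {within `[a, b], continuous p}.
  by apply: derivable_within_continuous => x _; have [] := hp x.
(* [p] vanishes at [0] and at [1], so a negative value in between would force
   [dp] to increase. *)
have [x1 /[!in_itv]/= /andP[x10 x1y]] := MVT y0 (fun x _ => hp x) (pc _ _).
have [x2 /[!in_itv]/= /andP[x2y x21]] := MVT y1 (fun x _ => hp x) (pc _ _).
have -> : p 1 = 0 by rewrite /p mul1r mulr1 subrr.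
have -> : p 0 = 0 by rewrite /p mul0r mulr0 sin0 subrr.
have pi0 := pi_gt0 R.
have dp12 : dp x2 <= dp x1.
  rewrite /dp lerD2r ler_pM2l ?divr_gt0// leNgt; apply/negP.
  have pI (x : R) : 0 < x -> x < 1 -> pi / 4 * x \in `[0, pi]%R.
    by move=> xgt0 xlt1; rewrite in_itv/= mulr_ge0 ?divr_ge0 ?ltW//=; nra.
  have x12 : x1 < x2 by exact: lt_trans x2y.
  rewrite ltr_cos ?pI ?(lt_trans x12 x21) ?(lt_trans x10 x12)//.
  by rewrite ltr_pM2l ?divr_gt0// ltNge ltW.
rewrite sub0r !subr0 => e2 e1; rewrite -subr_ge0 -/(p y) leNgt; apply/negP => py.
have : dp x1 < 0 by rewrite -(pmulr_llt0 _ y0) -e1.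
have : 0 < dp x2 by rewrite -(pmulr_lgt0 _ (_ : 0 < 1 - y)) -?e2 ?oppr_gt0 ?subr_gt0.
by move: dp12; lra.
Qed.

(** The left-hand side is [cos (pi * a / 2) = 1 - 2 * sin (pi * a / 4) ^+ 2]. The chord bound at
    half the angle can be squared, and [sin (pi / 4) ^+ 2 = 1 / 2]. *)
Lemma sin_le_1BX2 (R : realType) (a : R) : -1 < a < 1 ->
  sin (pi * (1 + a) / 2) <= 1 - a ^+ 2.
Proof.
move=> aI; have -> : pi * (1 + a) / 2 = pi / 2 * a + pi / 2 by field.
rewrite sinDpihalf -cos_norm normrM (ger0_norm (_ : 0 <= pi / 2)).
  have y01 : 0 <= `|a| <= 1 by rewrite normr_ge0 ltW// ltr_norml.
  rewrite -real_normK ?num_real//; move: `|a| y01 => y y01.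
  have := chord_sin_le y01.
  have -> : pi / 2 * y = (pi / 4 * y) *+ 2 by field.
  rewrite cos_mulr2n cos2sin2.
  have := cos_pihalf R; have -> : (pi / 2 : R) = (pi / 4) *+ 2 by field.
  rewrite cos_mulr2n cos2sin2.
  have : 0 <= sin (pi / 4 : R).
    by apply: sin_ge0_pi; have := pi_gt0 R; lra.
  move: (sin _) => S; move: (sin _) => T S0 S2 ST.
  have : (y * S) ^+ 2 <= T ^+ 2.
    have yS0 : 0 <= y * S by case/andP: y01 => ? _; rewrite mulr_ge0.
    by rewrite ler_sqr ?nnegrE// (le_trans yS0).
  by rewrite exprMn; nra.
by rewrite divr_ge0 ?pi_ge0.
Qed.

Lemma cos_2piB (R : realType) (x : R) : cos (2 * pi - x) = cos x.
Proof. by rewrite mulr_natl -[LHS]cosN opprB -[LHS]cosD2pi subrK. Qed.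

Lemma sin_2piB (R : realType) (x : R) : sin (2 * pi - x) = - sin x.
Proof.
by rewrite mulr_natl -[LHS]opprK -[in LHS]sinN opprB -[in LHS]sinD2pi subrK.
Qed.

(* Bathtub principle: among the functions with values in [[-1, 1]] and mean [a],
   the first Fourier coefficient is maximal for the indicator [+1] on an arc and
   [-1] off it; the half-length of this arc is [pi * (1 + a) / 2]. *)
Lemma strip_gradient_circle (R : realType) (f G : R -> R) (a : R) :
  -1 < a < 1 -> (forall t, -1 < f t < 1) ->
  (forall t, 0 <= t <= 2 * pi ->
    is_derive t 1 G ((f t - a) * (cos t - cos (pi * (1 + a) / 2)))) ->
  G (2 * pi) - G 0 <= 4 * sin (pi * (1 + a) / 2).
Proof.
move=> /andP[a1 a2] fI; have pi0 := pi_gt0 R.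
set k := pi * (1 + a) / 2 => hG.
have k0 : 0 < k by rewrite divr_gt0// mulr_gt0//; lra.
have kpi : k < pi by rewrite /k; nra.
(* A primitive of the integrand with [f t - a] replaced by the constant [c]: this is [1 - a] on the
   arc where [cos t >= cos k], and [- 1 - a] on the complementary arc. *)
pose M c (t : R) := c * (sin t - cos k * t).
have hM (c t : R) : is_derive t 1 (M c) (c * (cos t - cos k)).
  by rewrite /M; apply: is_derive_eq; rewrite /GRing.scale/=; ring.
have kI : k \in `[0, pi]%R by rewrite in_itv/= !ltW.
have cosge t : 0 <= t <= k -> cos k <= cos t.
  move=> /andP[t0 tk]; rewrite leNgt ltr_cos// ?in_itv/= ?t0 ?(le_trans tk) ?ltW//.
  by rewrite -leNgt.
have cosle t : k <= t <= pi -> cos t <= cos k.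
  move=> /andP[kt tpi]; rewrite leNgt ltr_cos// ?in_itv/= ?tpi ?(le_trans (ltW k0))//.
  by rewrite -leNgt.
have inc c x y : 0 <= x -> x <= y -> y <= 2 * pi ->
    (forall t, x <= t <= y ->
      (f t - a) * (cos t - cos k) <= c * (cos t - cos k)) ->
    G y - G x <= M c y - M c x.
  move=> x0 xy y2 le; apply: (le_increment xy _ (fun t _ => hM c t) le) => t tI.
  by apply: hG; lra.
have h1 : G k - G 0 <= M (1 - a) k - M (1 - a) 0.
  apply: inc => //; [exact: ltW|by lra|] => t tI.
  rewrite ler_wpM2r ?subr_ge0 ?cosge//; have := fI t; lra.
have h2 : G (2 * pi - k) - G k <= M (- 1 - a) (2 * pi - k) - M (- 1 - a) k.
  apply: inc; [exact: ltW|by lra|by lra|] => t tI.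
  rewrite ler_wnM2r ?subr_le0//; last by have := fI t; lra.
  have [tpi|tpi] := leP t pi; first by apply: cosle; lra.
  by rewrite -cos_2piB cosle//; lra.
have h3 : G (2 * pi) - G (2 * pi - k) <= M (1 - a) (2 * pi) - M (1 - a) (2 * pi - k).
  apply: inc => //; [by lra|by lra|] => t tI.
  rewrite ler_wpM2r ?subr_ge0//; last by have := fI t; lra.
  by rewrite -[leRHS]cos_2piB cosge//; lra.
(* The half-length [k] is exactly the one for which the terms in [cos k] cancel, leaving
   [4 * sin k]. *)
have kE : 2 * k = pi * (1 + a) by rewrite /k; field.
have : G (2 * pi) - G 0 <= (1 - a) * (2 * (sin k - cos k * k)) +
   (1 + a) * (2 * (sin k + cos k * pi - cos k * k)).
  move: h1 h2 h3; rewrite /M sin_2piB sin0.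
  have -> : sin (2 * pi : R) = 0 by rewrite mulr_natl sin2pi.
  by lra.
by have := congr1 ( *%R (cos k)) kE; lra.
Qed.

(* The kernel [cos t - k], with [k = cos (pi * (1 + a) / 2)], is extended from
   the circle of radius [r] by [(z / r + r / z) / 2 - k]; multiplied by
   [F z - F 0] it has the limit [F^`() 0 * r / 2] at the origin. *)
Lemma strip_derivative_at0 (R : realType) (F : R[i]^o -> R[i]^o) (D : R[i]^o) :
  (forall z, normc z < 1 -> derivable F z 1) ->
  (forall z, normc z < 1 -> -1 < complex.Re (F z) < 1) ->
  is_derive (0 : R[i]^o) 1 F D ->
  complex.Re D <= 4 / pi * (1 - complex.Re (F 0) ^+ 2).
Proof.
move=> dF FI dF0.
have pi0 := pi_gt0 R.
have aI : -1 < complex.Re (F 0) < 1 by apply: FI; rewrite Normc.normc0.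
apply: (@le_trans _ _ (4 / pi * sin (pi * (1 + complex.Re (F 0)) / 2))); last first.
  by rewrite ler_wpM2l ?divr_ge0 ?(ltW pi0)// sin_le_1BX2.
set a := complex.Re (F 0) in aI *; set k := cos (pi * (1 + a) / 2).
set Y := 4 / pi * _.
(* No limit [r -> 1] is taken: if [Y] were smaller than [Re D], the radius [(Re D + Y) / (2 * Re D)]
   would already contradict the bound. *)
suff rD r : 0 < r < 1 -> r * complex.Re D <= Y.
  have Y0 : 0 <= Y.
    rewrite mulr_ge0 ?divr_ge0 ?(ltW pi0)// sin_ge0_pi//.
    by move/andP: aI => [? ?]; apply/andP; split; nra.
  rewrite leNgt; apply/negP => YD.
  have D0 : 0 < complex.Re D by exact: le_lt_trans YD.
  have := rD ((complex.Re D + Y) / (2 * complex.Re D)).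
  have -> : (complex.Re D + Y) / (2 * complex.Re D) * complex.Re D =
      (complex.Re D + Y) / 2.
    by field; rewrite gt_eqF.
  rewrite ltr_pdivrMr ?ltr_pdivlMr ?mulr_gt0//; lra.
move=> /andP[r0 r1].
(* [m z] is [z] times the extended kernel, so [h] is the difference quotient of [F] at [0] times a
   polynomial whose value at [0] is [r / 2]. *)
pose m (z : R[i]^o) : R[i]^o := (z ^+ 2 / r%:C + r%:C - 2 * k%:C * z) / 2.
pose h (z : R[i]^o) : R[i]^o := (F z - F 0) / z * m z.
have dm z : derivable m z 1 by exact: ex_derive.
have dh z : 0 < normc z < 1 -> derivable h z 1.
  move=> /andP[z0 z1].
  have zn0 : z != 0 by apply: contraTneq z0 => ->; rewrite Normc.normc0 ltxx.
  apply: derivableM => //; apply: derivableM; last exact: derivableV.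
  by apply: derivableB; [exact: dF|exact: derivable_cst].
have hl : h z @[z --> (0 : R[i]^o)^'] --> (D * (r%:C / 2) : R[i]^o).
  apply: cvgM.
    have [dF0' <-] := dF0.
    rewrite (_ : (fun z => _) = fun z : R[i]^o =>
      z^-1 *: ((F \o shift 0) (z *: 1) - F 0)) //.
    by apply/funext => z; rewrite /GRing.scale/= mulr1 addr0 mulrC.
  have -> : (r%:C / 2 : R[i]^o) = m 0 by rewrite /m expr0n mul0r mulr0 subr0 add0r.
  apply: cvg_within_filter; apply: differentiable_continuous.
  exact/derivable1_diffP.
have r01 : 0 < r < 1 by rewrite r0.
have [G hG G2] := @circle_mean R h dh r _ r01 hl.
have := @strip_gradient_circle R
  (fun t => complex.Re (F ((r * cos t) +i* (r * sin t)))) G a aI.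
have rc t : normc ((r * cos t) +i* (r * sin t) : R[i]) = r.
  by rewrite /= !exprMn -mulrDr cos2Dsin2 mulr1 sqrtr_sqr ger0_norm// ltW.
rewrite G2 => /(_ _ _)/wrap[t|t tI|].
- by rewrite FI ?rc.
- have := hG t tI; congr (is_derive _ _ _ _).
  have zn0 : (r * cos t) +i* (r * sin t) != 0 :> R[i].
    by apply: contraTneq r0 => z0; rewrite -(rc t) z0 Normc.normc0 ltxx.
  rewrite /h; set z := _ +i* _ in zn0 *.
  (* On the circle, [E ^+ 2 + 1 = 2 * cos t * E], which makes the kernel real. *)
  have -> : m z = z * (cos t - k)%:C.
    pose E : R[i] := (cos t) +i* (sin t).
    have EE : E ^+ 2 = 2 * (cos t)%:C * E - 1.
      rewrite expr2; apply/eqP; rewrite eq_complex /=; apply/andP; split; apply/eqP.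
        have := sin2cos2 t; lra.
      lra.
    have zE : z = r%:C * E.
      by apply/eqP; rewrite eq_complex /= !mul0r subr0 addr0 !eqxx.
    have rC0 : r%:C != 0 :> R[i] by rewrite (inj_eq (@complexI R)) gt_eqF.
    have -> : m z = r%:C * (E ^+ 2 + 1 - 2 * k%:C * E) / 2.
      by rewrite /m zE; field.
    by rewrite EE zE rmorphB /=; field.
  have ReM (x : R[i]) (c : R) : complex.Re (x * c%:C) = complex.Re x * c.
    by case: x => ? ? /=; rewrite mulr0 subr0.
  by rewrite mulrA divfK// ReM raddfB.
have -> : complex.Re (D * (r%:C / 2)) = r * complex.Re D / 2.
  have -> : r%:C / 2 = (r / 2)%:C by rewrite rmorphM fmorphV rmorph_nat.
  by case: (D) => ? ? /=; rewrite mulr0 subr0 mulrA [_ * r]mulrC.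
move=> h4; rewrite /Y mulrAC ler_pdivlMr//; lra.
Qed.

(** * From the disc to the ball *)

(** Agreement of [phi] with the real part of [g] is asked for near [0] only, since a pluriharmonic
    [f] is tied to [F] inside the ball only. *)
Lemma is_derive_Re_line (R : realType) (g : R[i]^o -> R[i]^o) (D u : R[i]^o)
    (phi : R -> R) (d : R) : normc u = 1 -> 0 < d ->
  (forall t : R, `|t| < d -> phi t = complex.Re (g (t%:C * u))) ->
  is_derive (0 : R[i]^o) 1 g D -> is_derive (0 : R) 1 phi (complex.Re (D * u)).
Proof.
move=> u1 d0 phiE /is_deriveC_epsP gD; apply/is_derive_epsP => e e0.
have [d' d'0 hd] := gD e e0; exists (Num.min d d'); first by rewrite lt_min d0.
move=> t; rewrite subr0 lt_min => /andP[td td'].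
have tu : normc (t%:C * u) = `|t|.
  by rewrite Normc.normcM u1 mulr1 /= expr0n addr0 sqrtr_sqr.
have := hd (t%:C * u); rewrite subr0 tu => /(_ td'); apply: le_trans.
rewrite phiE// phiE ?normr0// rmorph0 mul0r.
have := normc_Re (g (t%:C * u) - g 0 - D * (t%:C * u)).
apply: le_trans; rewrite le_eqVlt; apply/orP; left; apply/eqP; congr `|_|.
rewrite !raddfB /= mulrCA; congr (_ - _).
by case: (D * u) => ? ? /=; rewrite mul0r subr0 mulrC.
Qed.

(** * Slices of the ball by complex lines *)

Definition sqnorm (R : realType) (n : nat) (z : 'rV[R[i]^o]_n) : R :=
  \sum_(k < n) (complex.Re (z 0 k) ^+ 2 + complex.Im (z 0 k) ^+ 2).

Definition hdot (R : realType) (n : nat) (z w : 'rV[R[i]^o]_n) : R[i] :=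
  \sum_(k < n) z 0 k * (w 0 k)^*.

Section ball.
Context (R : realType) (n : nat).
Implicit Types (z v : 'rV[R[i]^o]_n).

Lemma sqnorm_ge0 z : 0 <= sqnorm z.
Proof. by apply: sumr_ge0 => k _; rewrite addr_ge0 ?sqr_ge0. Qed.

Lemma enorm_sqr z : enorm z ^+ 2 = sqnorm z.
Proof. by rewrite sqr_sqrtr ?sqnorm_ge0. Qed.

Lemma unit_ballE z : unit_ball z <-> sqnorm z < 1.
Proof. by rewrite /unit_ball /= /enorm -[X in _ < X]sqrtr1 ltr_sqrt. Qed.

Lemma sqnorm_line z v (l : R[i]) :
  sqnorm (z + l *: v) = sqnorm z + 2 * complex.Re (l * (hdot z v)^*) +
    (complex.Re l ^+ 2 + complex.Im l ^+ 2) * sqnorm v.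
Proof.
rewrite /sqnorm /hdot rmorph_sum /= mulr_sumr raddf_sum /= !mulr_sumr -!big_split /=.
apply: eq_bigr => k _; rewrite !mxE /GRing.scale/=.
case: l (z 0 k) (v 0 k) => [a b] [x y] [u w] /=; ring.
Qed.

(** Cauchy-Schwarz for a unit vector [v], from the squared norm of [z - hdot z v *: v] being
    nonnegative. *)
Lemma hdot_sqr_le z v : sqnorm v = 1 ->
  complex.Re (hdot z v) ^+ 2 + complex.Im (hdot z v) ^+ 2 <= sqnorm z.
Proof.
move=> v1; have := sqnorm_ge0 (z + (- hdot z v) *: v).
rewrite sqnorm_line v1; case: (hdot z v) => a b /=; nra.
Qed.

Lemma unit_ball_line z v : unit_ball z -> exists2 d : R, 0 < d &
  forall l : R[i], normc l < d -> unit_ball (z + l *: v).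
Proof.
rewrite unit_ballE => z1.
have s0 : 0 < 1 - sqnorm z by rewrite subr_gt0.
set c := hdot z v.
(* For [normc l < 1] the quadratic term of [sqnorm_line] is bounded by a linear one, so [sqnorm]
   grows by at most [K * normc l]. *)
pose K := 2 * normc c + sqnorm v + 1.
have K0 : 0 < K by rewrite ltr_pwDr// addr_ge0 ?sqnorm_ge0// mulr_ge0 ?normc_ge0.
exists (Num.min 1 ((1 - sqnorm z) / K)); first by rewrite lt_min ltr01 divr_gt0.
move=> l; rewrite lt_min ltr_pdivlMr// => /andP[l1 lK].
rewrite unit_ballE sqnorm_line -/c.
have := normc_Re (l * c^*); rewrite Normc.normcM => lc.
have cc : normc c^* = normc c by case: (c) => a b /=; rewrite sqrrN.
have ll : complex.Re l ^+ 2 + complex.Im l ^+ 2 = normc l ^+ 2.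
  by case: (l) => a b /=; rewrite sqr_sqrtr ?addr_ge0 ?sqr_ge0.
rewrite ll; move: lc; rewrite cc ler_norml => /andP[_ lc].
have l0 := normc_ge0 l; have v0 := sqnorm_ge0 v.
have : normc l ^+ 2 * sqnorm v <= normc l * sqnorm v.
  by rewrite ler_wpM2r// expr2 ler_piMl// ltW.
by move: lK lc; rewrite /K; lra.
Qed.

(* The Moebius parametrization of the slice of the ball by the line
   [z + C v]: the slice is a disc of radius at most [1]. *)
Lemma unit_ball_moebius z v (l : R[i]) :
  sqnorm v = 1 -> unit_ball z -> normc l < 1 ->
  1 + (hdot z v)^* * l != 0 /\
  unit_ball (z + (l * (1 - sqnorm z)%:C / (1 + (hdot z v)^* * l)) *: v).
Proof.
move=> v1; rewrite !unit_ballE => z1 l1.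
have := hdot_sqr_le z v1; rewrite sqnorm_line v1 mulr1.
set s := 1 - sqnorm z.
have s0 : 0 < s by rewrite subr_gt0.
case: (hdot z v) => a b cz; rewrite /= in cz.
case: l l1 => x y l1; rewrite /= in l1.
have {}l1 : x ^+ 2 + y ^+ 2 < 1.
  by move: l1; rewrite -[X in _ < X]sqrtr1 ltr_sqrt.
(* [p + i q] is the product of [l] with the conjugate of [hdot z v]; Cauchy-Schwarz bounds its
   squared modulus by [(1 - s) * (x ^+ 2 + y ^+ 2)]. *)
pose p := a * x + b * y; pose q := a * y - b * x.
have pq1 : p ^+ 2 + q ^+ 2 < 1 - s * (x ^+ 2 + y ^+ 2).
  have -> : p ^+ 2 + q ^+ 2 = (a ^+ 2 + b ^+ 2) * (x ^+ 2 + y ^+ 2).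
    by rewrite /p /q; ring.
  by move: (sqr_ge0 x) (sqr_ge0 y); rewrite /s in s0 *; nra.
have xy0 : 0 <= s * (x ^+ 2 + y ^+ 2) by rewrite mulr_ge0 ?(ltW s0) ?addr_ge0 ?sqr_ge0.
have n0 : 0 < (1 + p) ^+ 2 + q ^+ 2.
  have : -1 < p by nra.
  by move: (sqr_ge0 q) => q0 p1; rewrite ltr_pwDl// exprn_gt0//; lra.
have -> : 1 + (a +i* b)^* * (x +i* y) = (1 + p) +i* q.
  by apply/eqP; rewrite eq_complex /= /p /q; apply/andP; split; apply/eqP; ring.
split.
  apply: contraTneq n0 => /eqP; rewrite eq_complex /= => /andP[/eqP-> /eqP->].
  by rewrite expr0n addr0 ltxx.
have -> : (x +i* y) * s%:C / ((1 + p) +i* q) =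
    (s * (x * (1 + p) + y * q) / ((1 + p) ^+ 2 + q ^+ 2)) +i*
    (s * (y * (1 + p) - x * q) / ((1 + p) ^+ 2 + q ^+ 2)).
  apply/eqP; rewrite eq_complex /=.
  by apply/andP; split; apply/eqP; field; rewrite gt_eqF.
set N := (1 + p) ^+ 2 + q ^+ 2 in n0 *.
(* [A + i B] is [l] times the conjugate of the denominator, whose squared modulus is [N]. *)
set A := x * (1 + p) + y * q; set B := y * (1 + p) - x * q.
have hAB : A * a + B * b = p * (1 + p) + q ^+ 2 by rewrite /A /B /p /q; ring.
have hN : A ^+ 2 + B ^+ 2 = (x ^+ 2 + y ^+ 2) * N by rewrite /A /B /N; ring.
rewrite /= (_ : sqnorm z + _ + _ = 1 - s + s * (2 * (A * a + B * b) / N +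
    s * (A ^+ 2 + B ^+ 2) / N ^+ 2)); last by rewrite /s; field; rewrite gt_eqF.
rewrite hAB hN (_ : s * (_ * N) / _ = s * (x ^+ 2 + y ^+ 2) / N); last first.
  by field; rewrite gt_eqF.
(* Dividing by [s] and multiplying by [N] reduces the claim to [p ^+ 2 + q ^+ 2 + s * (x ^+ 2 + y ^+
   2) < 1], which is [pq1]. *)
rewrite -mulrDl -[X in _ < X](subrK s) ltrD2l gtr_pMr// ltr_pdivrMr// mul1r /N.
by move: pq1; lra.
Qed.

End ball.

Lemma derivable_comp_line (R : realType) (n : nat) (F : 'rV[R[i]^o]_n -> R[i]^o)
    (z v : 'rV[R[i]^o]_n) (mu : R[i]^o -> R[i]^o) (l : R[i]^o) :
  differentiable F (z + mu l *: v) -> derivable mu l 1 ->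
  is_derive l 1 (fun x => F (z + mu x *: v)) ('D_1 mu l *: 'd F (z + mu l *: v) v).
Proof.
move=> dF /derivable1_diffP dmu.
have dp : differentiable (fun x => z + mu x *: v) l.
  by apply: differentiableD => //; exact: differentiableZl.
have dFp : differentiable (F \o (fun x => z + mu x *: v)) l.
  exact: differentiable_comp.
apply: DeriveDef; first exact/derivable1_diffP.
rewrite deriveE// diff_comp//= -linearZ /=; congr ('d F _ _).
have dmuv : differentiable (fun x => mu x *: v) l by exact: differentiableZl.
have e1 := @diffZl R[i] R[i]^o 'rV[R[i]^o]_n mu v l dmu.
have e2 := @diff_cst R[i] R[i]^o 'rV[R[i]^o]_n z l.
have e3 := @diffD R[i] R[i]^o 'rV[R[i]^o]_n (cst z) (fun x => mu x *: v) l
  (differentiable_cst _ _) dmuv.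
have {}e1 : 'd (fun x => mu x *: v) l 1 = 'd mu l 1 *: v := congr1 (@^~ 1) e1.
have {}e2 : 'd (cst z) l (1 : R[i]^o) = 0 := congr1 (@^~ 1) e2.
have {}e3 : 'd (fun x => z + mu x *: v) l 1 =
  'd (cst z) l 1 + 'd (fun x => mu x *: v) l 1 := congr1 (@^~ 1) e3.
(* Rewriting under ['d] makes unification diverge here. *)
apply: (eq_trans e3); apply: (eq_trans (congr1 (+%R^~ _) e2)).
apply: (eq_trans (add0r _)); apply: (eq_trans e1).
by congr (_ *: _); exact: esym (deriveE _ dmu).
Qed.

(** * The real gradient and the complex differential *)

Section gradient.
Context (R : realType) (n : nat).
Context (f : 'rV[R[i]^o]_n -> R) (F : 'rV[R[i]^o]_n -> R[i]^o).
Hypothesis dF : holomorphic_on (@unit_ball R n) F.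
Hypothesis fF : forall z, unit_ball z -> f z = complex.Re (F z).

(** The choices [u = 1] and [u = 'i] give the partial derivatives in [x_k] and [y_k]. *)
Lemma is_derive_unit_line (z v : 'rV[R[i]^o]_n) (u : R[i]^o) :
  normc u = 1 -> unit_ball z ->
  is_derive (0 : R) 1 (fun t : R => f (z + (t%:C * u) *: v))
    (complex.Re ('d F z v * u)).
Proof.
move=> u1 zB; have [d d0 hd] := unit_ball_line v zB.
have tu (t : R) : normc (t%:C * u) = `|t|.
  by rewrite Normc.normcM u1 mulr1 /= expr0n addr0 sqrtr_sqr.
apply: (is_derive_Re_line (g := fun l : R[i]^o => F (z + l *: v)) u1 d0).
  by move=> t td; rewrite fF//; apply: hd; rewrite tu.
have := @derivable_comp_line R n F z v id 0.
rewrite scale0r addr0 derive_id scale1r; apply => //; exact: dF.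
Qed.

Lemma partial_xE (z : 'rV[R[i]^o]_n) (k : 'I_n) : unit_ball z ->
  partial_x f k z = complex.Re ('d F z (delta_mx 0 k)).
Proof.
move=> zB; have [_ e] := @is_derive_unit_line z (delta_mx 0 k) 1 (Normc.normc1 R) zB.
have eD : 'd F z (delta_mx 0 k) * 1 = 'd F z (delta_mx 0 k) := mulr1 _.
rewrite -(congr1 _ eD) -e /partial_x derive1E.
have <- : (fun t : R => f (z + (t +i* 0) *: delta_mx 0 k)) =
    (fun t : R => f (z + (t%:C * 1) *: delta_mx 0 k)).
  by apply/funext => t; congr (f (_ + _ *: _)); exact: esym (mulr1 _).
by [].
Qed.

Lemma partial_yE (z : 'rV[R[i]^o]_n) (k : 'I_n) : unit_ball z ->
  partial_y f k z = - complex.Im ('d F z (delta_mx 0 k)).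
Proof.
have i1 : normc ('i : R[i]) = 1 by rewrite /= expr0n expr1n add0r sqrtr1.
move=> zB; have [_ e] := @is_derive_unit_line z (delta_mx 0 k) 'i i1 zB.
rewrite -ReiNIm -e /partial_y derive1E.
have <- : (fun t : R => f (z + (0 +i* t) *: delta_mx 0 k)) =
    (fun t : R => f (z + (t%:C * 'i) *: delta_mx 0 k)).
  apply/funext => t; congr (f (_ + _ *: _)); apply/eqP.
  by rewrite eq_complex /= !mul0r mulr0 subr0 mulr1 addr0 !eqxx.
by [].
Qed.

(** Up to sign, the partial derivatives in [x_k] and [y_k] are the real and imaginary parts of one
    complex partial derivative of [F]. *)
Lemma grad_norm_sqr (z : 'rV[R[i]^o]_n) : unit_ball z ->
  grad_norm f z ^+ 2 =
  \sum_(k < n) (complex.Re ('d F z (delta_mx 0 k)) ^+ 2 +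
                complex.Im ('d F z (delta_mx 0 k)) ^+ 2).
Proof.
move=> zB; rewrite /grad_norm sqr_sqrtr; last first.
  by rewrite addr_ge0//; apply: sumr_ge0 => k _; exact: sqr_ge0.
rewrite -big_split /=; apply: eq_bigr => k _.
by congr (_ + _); rewrite (partial_xE, partial_yE)// sqrrN.
Qed.

(** The estimate on the disc is applied to [F] along the Moebius slice through [z] in the direction
    [v]. The slice has derivative [s *: v] at [0], so the composite has derivative [N * s] there. *)
Lemma grad_norm_le (z : 'rV[R[i]^o]_n) :
  (forall w, unit_ball w -> -1 < f w < 1) -> unit_ball z ->
  grad_norm f z * (1 - sqnorm z) <= 4 / pi * (1 - f z ^+ 2).
Proof.
move=> fI zB; set N := grad_norm f z.
have z1 : sqnorm z < 1 by exact/unit_ballE.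
have N0 : 0 <= N by exact: sqrtr_ge0.
have := N0; rewrite le_eqVlt => /predU1P[<-|{}N0].
  by rewrite mul0r mulr_ge0 ?divr_ge0 ?pi_ge0//; have := fI z zB; nra.
pose D k : R[i]^o := 'd F z (delta_mx 0 k).
have ND : N ^+ 2 = \sum_(k < n) (complex.Re (D k) ^+ 2 + complex.Im (D k) ^+ 2).
  exact: grad_norm_sqr.
have NC0 : N%:C != 0 :> R[i] by rewrite (inj_eq (@complexI R)) gt_eqF.
(* The conjugated complex gradient, normalized: the unit direction in which ['d F z] takes the real
   value [N]. *)
pose v : 'rV[R[i]^o]_n := \row_k ((D k)^* * N^-1%:C).
have v1 : sqnorm v = 1.
  have -> : sqnorm v = N ^- 2 * N ^+ 2; last by rewrite mulVf// expf_neq0// gt_eqF.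
  rewrite [X in _ * X]ND mulr_sumr; apply: eq_bigr => k _; rewrite mxE.
  by case: (D k) => x y /=; field; rewrite gt_eqF.
have dFv : 'd F z v = N%:C.
  rewrite [v]row_sum_delta linear_sum/=.
  have -> : N%:C = (N ^+ 2)%:C * N^-1%:C :> R[i].
    by rewrite -rmorphM/= expr2 mulfK// gt_eqF.
  rewrite ND rmorph_sum/= mulr_suml; apply: eq_bigr => k _.
  rewrite linearZ/= mxE -/(D k) /GRing.scale/= mulrAC; congr (_ * _).
  case: (D k) => x y; apply/eqP; rewrite eq_complex /=.
  by apply/andP; split; apply/eqP; ring.
pose c := hdot z v; pose s := 1 - sqnorm z.
pose mu (l : R[i]^o) : R[i]^o := l * s%:C / (1 + c^* * l).
have mob (l : R[i]^o) : normc l < 1 -> 1 + c^* * l != 0 /\ unit_ball (z + mu l *: v).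
  by move=> l1; exact: unit_ball_moebius.
pose den (l : R[i]^o) : R[i]^o := 1 + c^* * l.
have dden (l : R[i]^o) : is_derive l 1 den c^* by exact: is_derive_affine.
have dnum (l : R[i]^o) : is_derive l 1 (fun l : R[i]^o => l * s%:C : R[i]^o) s%:C.
  by apply: is_derive_eq; rewrite /GRing.scale/= mulr0 add0r mulr1.
have dmu l : normc l < 1 -> derivable mu l 1.
  move=> l1; apply: derivableM; first by have [] := dnum l.
  by apply: derivableV; [exact: (mob l l1).1|have [] := dden l].
have n0 : normc (0 : R[i]) < 1 by rewrite Normc.normc0.
have dmu0 : 'D_1 mu 0 = s%:C.
  have d0 : den 0 != 0 by rewrite /den mulr0 addr0 oner_eq0.
  have [dd _] := dden 0.
  rewrite [LHS](deriveM _ (derivableV d0 dd)); last by have [] := dnum 0.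
  have [_ ->] := dnum 0.
  by rewrite /den mul0r scale0r add0r mulr0 addr0 invr1 scale1r.
have mu0 : mu 0 = 0 by rewrite /mu !mul0r.
have dg (l : R[i]^o) : normc l < 1 -> is_derive l 1 (fun l => F (z + mu l *: v))
    ('D_1 mu l *: 'd F (z + mu l *: v) v).
  by move=> l1; apply: derivable_comp_line; [exact: dF (mob l l1).2|exact: dmu].
have := @strip_derivative_at0 R (fun l => F (z + mu l *: v)) (N * s)%:C.
rewrite mu0 scale0r addr0 -fF//; apply.
- by move=> l l1; have [] := dg l l1.
- by move=> l l1; rewrite -fF ?fI//; have [] := mob l l1.
- have := dg 0 n0; rewrite mu0 scale0r addr0 dmu0 dFv; congr (is_derive _ _ _ _).
  by rewrite rmorphM mulrC.
Qed.

End gradient.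

(** * The extremal function *)

(* A logarithm on the right half-plane only. *)
Definition clog (R : realType) (z : R[i]^o) : R[i]^o :=
  ln (normc z) +i* atan (complex.Im z / complex.Re z).

Lemma clogK (R : realType) (z : R[i]^o) : 0 < complex.Re z -> cexp (clog z) = z.
Proof.
case: z => x y x0; rewrite /= in x0; rewrite /cexp /clog /=.
have x2 : 0 < x ^+ 2 by rewrite exprn_gt0.
have s0 : 0 < Num.sqrt (1 + (y / x) ^+ 2) by rewrite sqrtr_gt0 ltr_pwDl// sqr_ge0.
have nE : Num.sqrt (x ^+ 2 + y ^+ 2) = x * Num.sqrt (1 + (y / x) ^+ 2).
  have -> : x ^+ 2 + y ^+ 2 = x ^+ 2 * (1 + (y / x) ^+ 2) by field; rewrite gt_eqF.
  by rewrite sqrtrM ?ltW// sqrtr_sqr gtr0_norm.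
rewrite lnK; last by rewrite posrE nE mulr_gt0.
have cn0 : cos (atan (y / x)) != 0 by rewrite cos_atan invr_eq0 gt_eqF.
have -> : sin (atan (y / x)) = y / x * cos (atan (y / x)).
  by rewrite -{2}[y / x]atanK /tan divfK.
rewrite cos_atan nE; apply/eqP; rewrite eq_complex /=.
by apply/andP; split; apply/eqP; field; rewrite ?gt_eqF.
Qed.

Lemma lipschitz1_continuous (R : realType) (phi : R[i]^o -> R) :
  (forall z w, `|phi z - phi w| <= normc (z - w)) -> continuous phi.
Proof.
move=> hphi z.
apply/(@cvgrPdist_le R R _ _ (nbhs_filter z)) => e e0; apply/nbhs_ballP.
exists e%:C => /=; first by rewrite ltcR.
by move=> w; rewrite -ball_normE /= normC_normc ltcR => /ltW; exact: le_trans.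
Qed.

Lemma continuous_Re (R : realType) : continuous (@complex.Re R : R[i]^o -> R).
Proof. by apply: lipschitz1_continuous => z w; rewrite -raddfB normc_Re. Qed.

Lemma continuous_Im (R : realType) : continuous (@complex.Im R : R[i]^o -> R).
Proof. by apply: lipschitz1_continuous => z w; rewrite -raddfB normc_Im. Qed.

Lemma continuous_normc (R : realType) : continuous (@Normc.normc R : R[i]^o -> R).
Proof.
apply: lipschitz1_continuous => z w.
have tri (a b : R[i]) : normc a - normc b <= normc (a - b).
  by rewrite lerBlDr (le_trans _ (le_normcD _ _))// subrK.
by rewrite ler_norml tri andbT lerNl opprB (le_trans (tri _ _))// -normcN opprB.
Qed.

Lemma clog_near (R : realType) (z : R[i]^o) (e : R) : 0 < complex.Re z -> 0 < e ->
  exists2 d : R, 0 < d & forall w : R[i]^o, normc (w - z) < d ->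
    0 < complex.Re w /\ normc (clog w - clog z) < e.
Proof.
move=> z0 e0; have e20 : 0 < e / 2 by rewrite divr_gt0.
have nz : 0 < normc z.
  by rewrite (lt_le_trans _ (normc_Re _))// normr_gt0 gt_eqF.
have cln : {for z, continuous (fun w : R[i]^o => ln (normc w) : R)}.
  exact: (@continuous_comp _ _ _ (@Normc.normc R : R[i]^o -> R) (@ln R : R -> R) z
    (@continuous_normc R z) (continuous_ln nz)).
have cat : {for z, continuous
    (fun w : R[i]^o => atan (complex.Im w / complex.Re w) : R)}.
  apply: (@continuous_comp _ _ _
    (fun w : R[i]^o => complex.Im w / complex.Re w : R) (@atan R) z
    _ (@continuous_atan _ _)).
  apply: (@cvgM R _ _ (nbhs_filter z) (@complex.Im R)
    (fun w => (complex.Re w)^-1) _ _ (@continuous_Im R z)).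
  apply: (@cvgV R _ _ (nbhs_filter z) (@complex.Re R) _ _ (@continuous_Re R z)).
  by rewrite gt_eqF.
have : \forall w \near z, [/\ 0 < complex.Re w,
    `|ln (normc z) - ln (normc w)| < e / 2 &
    `|atan (complex.Im z / complex.Re z) -
      atan (complex.Im w / complex.Re w)| < e / 2].
  near=> w; split; near: w.
  - exact: (@cvgr_gt R _ _ (nbhs_filter z) _ _ (@continuous_Re R z)).
  - exact: ((@cvgrPdist_lt R R _ _ (nbhs_filter z) _ _).1 cln).
  - exact: ((@cvgrPdist_lt R R _ _ (nbhs_filter z) _ _).1 cat).
move=> /nbhs_ballP[[d d'] dd' hd].
have [d'0 d0] : d' = 0 /\ 0 < d by move: dd'; rewrite /= ltcE/= => /andP[/eqP].
rewrite {}d'0 {dd'} in hd; exists d => // w wd.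
have /hd[w0 h1 h2] : ball z d%:C w.
  by rewrite -ball_normE /= distrC normC_normc ltcR.
split; first by [].
apply: le_lt_trans (normc_leD _) _ => /=.
by rewrite distrC [X in _ + X]distrC (_ : e = e / 2 + e / 2) ?ltrD//; field.
Unshelve. all: by end_near. Qed.

(** Inverse function argument: the expansion of [cexp] at [clog z] is solved for the increment [L]
    of [clog], which is small by [clog_near]. *)
Lemma is_derive_clog (R : realType) (z : R[i]^o) : 0 < complex.Re z ->
  is_derive z 1 (@clog R) z^-1.
Proof.
move=> z0; apply/is_deriveC_epsP => e e0.
have zn0 : z != 0 by apply: contraTneq z0 => ->; rewrite ltxx.
have r0 : 0 < normc z.
  by rewrite (lt_le_trans _ (normc_Re _))// normr_gt0 gt_eqF.
set r := normc z in r0.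
(* The bound [r / 2] lets half of [r * normc L] absorb the error, so
   [r * normc L <= 2 * normc (w - z)]; with [e * r ^+ 2 / 2] the error divided by [r] is then at
   most [e * normc (w - z)]. *)
pose h := Num.min (r / 2) (e * r ^+ 2 / 2).
have h0 : 0 < h by rewrite lt_min !divr_gt0// mulr_gt0// exprn_gt0.
have := is_derive_cexp (clog z); rewrite clogK//.
move=> /is_deriveC_epsP/(_ h h0)[d1 d10 hd1].
have [d d0 hd] := clog_near z0 d10; exists d => // w wd.
have [w0 {hd}/hd1] := hd w wd; rewrite !clogK//.
set L := clog w - clog z => hL.
have E1 : L - z^-1 * (w - z) = - z^-1 * (w - z - z * L).
  by field.
rewrite E1 Normc.normcM normcN Normc.normcV -/r mulrC ler_pdivrMr//.
apply: (le_trans hL).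
have L1 : r * normc L <= normc (w - z) + h * normc L.
  rewrite -Normc.normcM (_ : z * L = (w - z) - (w - z - z * L)); last by ring.
  by rewrite (le_trans (le_normcD _ _))// normcN lerD2l.
have hr : h <= r / 2 by rewrite ge_min lexx.
have he : h <= e * r ^+ 2 / 2 by rewrite ge_min lexx orbT.
have L0 : 0 <= normc L := normc_ge0 _.
have L2 : r * normc L <= 2 * normc (w - z) by nra.
apply: (le_trans (ler_wpM2r L0 he)).
have -> : e * r ^+ 2 / 2 * normc L = e / 2 * r * (r * normc L) by ring.
have -> : e * normc (w - z) * r = e / 2 * r * (2 * normc (w - z)) by field.
by rewrite ler_wpM2l// !mulr_ge0// ltW.
Qed.

(* [4 / pi * arctan l], which maps the unit disc conformally onto the strip
   [-1 < Re < 1]. *)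
Definition strip_map (R : realType) (l : R[i]^o) : R[i]^o :=
  (0 -i* (2 / pi)) * clog ((1 + 'i%C * l) / (1 - 'i%C * l)).

(** Cayley transform of ['i * l]: the real part is [1] minus the squared modulus of [l], divided by
    the squared modulus of the denominator. *)
Lemma half_plane_map (R : realType) (l : R[i]^o) : normc l < 1 ->
  1 - 'i%C * l != 0 /\ 0 < complex.Re ((1 + 'i%C * l) / (1 - 'i%C * l)).
Proof.
case: l => x y l1; rewrite /= in l1.
have {}l1 : x ^+ 2 + y ^+ 2 < 1.
  by move: l1; rewrite -[X in _ < X]sqrtr1 ltr_sqrt.
have n0 : 0 < (1 + y) ^+ 2 + x ^+ 2.
  have : -1 < y by nra.
  by move: (sqr_ge0 x) => x0 y1; rewrite ltr_pwDl// exprn_gt0//; lra.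
have dE : 1 - 'i%C * (x +i* y) = (1 + y) -i* x.
  by apply/eqP; rewrite eq_complex /=; apply/andP; split; apply/eqP; ring.
have nE : 1 + 'i%C * (x +i* y) = (1 - y) +i* x.
  by apply/eqP; rewrite eq_complex /=; apply/andP; split; apply/eqP; ring.
rewrite dE nE; split.
  apply: contraTneq n0 => /eqP; rewrite eq_complex /= oppr_eq0 => /andP[/eqP-> /eqP->].
  by rewrite expr0n addr0 ltxx.
have -> : complex.Re (((1 - y) +i* x) / ((1 + y) -i* x)) =
    (1 - (x ^+ 2 + y ^+ 2)) / ((1 + y) ^+ 2 + x ^+ 2).
  by rewrite /= sqrrN; field; rewrite gt_eqF.
by rewrite divr_gt0// subr_gt0.
Qed.

(** The real part is [2 / pi] times a value of [atan]. *)
Lemma Re_strip_map (R : realType) (l : R[i]^o) : -1 < complex.Re (strip_map l) < 1.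
Proof.
rewrite /strip_map /clog; set t := (X in atan X); rewrite /= mul0r sub0r mulNr opprK.
have pi0 := pi_gt0 R; have p2 : pi != 0 :> R by rewrite gt_eqF.
have := atan_ltpi2 t; have := atan_gtNpi2 t; move: (atan t) => u u1 u2.
by rewrite mulrAC ltr_pdivlMr// ltr_pdivrMr//; apply/andP; split; lra.
Qed.

(** The derivative is [4 / (pi * (1 + l ^+ 2))], kept in the form given by the chain rule. *)
Lemma is_derive_strip_map (R : realType) (l : R[i]^o) : normc l < 1 ->
  is_derive l 1 (@strip_map R)
    ((0 -i* (2 / pi)) * (2 * 'i%C / ((1 + 'i%C * l) * (1 - 'i%C * l)))).
Proof.
move=> l1; have [d0 q0] := half_plane_map l1.
have n0 : 1 + 'i%C * l != 0.
  by apply: contraTneq q0 => ->; rewrite mul0r ltxx.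
pose num (l : R[i]^o) : R[i]^o := 1 + 'i%C * l.
pose den (l : R[i]^o) : R[i]^o := 1 - 'i%C * l.
have dnum : is_derive l 1 num 'i%C by exact: is_derive_affine.
have dden : is_derive l 1 den (- 'i%C).
  have -> : den = fun l => 1 + (- 'i%C) * l by apply/funext => y; rewrite mulNr.
  exact: is_derive_affine.
have dinv : is_derive l 1 (fun l => (den l)^-1) (- den l ^- 2 * - 'i%C).
  have [dd e] := dden.
  by apply: DeriveDef; [exact: derivableV|rewrite deriveV// e].
have dq : is_derive l 1 (fun l => num l * (den l)^-1) (2 * 'i%C / den l ^+ 2).
  apply: (is_derive_eq (is_deriveM dnum dinv)).
  by rewrite /GRing.scale/= /num /den; field.
have dlog := @is_derive_comp _ (@clog R) (fun l => num l * (den l)^-1) l _ _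
  (is_derive_clog q0) dq.
apply: (is_derive_eq (is_deriveZ (0 -i* (2 / pi) : R[i]^o) dlog)).
by rewrite /GRing.scale/= /num /den; congr (_ * _); field; rewrite ?n0 ?d0.
Qed.

Lemma strip_map0 (R : realType) : strip_map (0 : R[i]^o) = 0.
Proof.
rewrite /strip_map mulr0 addr0 subr0 divr1.
have -> : clog (1 : R[i]^o) = 0.
  by rewrite /clog Normc.normc1 ln1 /= mul0r atan0.
by rewrite mulr0.
Qed.

Lemma is_derive_strip_map0 (R : realType) :
  is_derive (0 : R[i]^o) 1 (@strip_map R) (4 / pi)%:C.
Proof.
have n0 : normc (0 : R[i]) < 1 by rewrite Normc.normc0.
apply: (is_derive_eq (is_derive_strip_map n0)).
have p0 : pi != 0 :> R by rewrite gt_eqF ?pi_gt0.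
move: (pi : R) p0 => p p0; rewrite mulr0 addr0 subr0 mulr1 divr1.
by apply/eqP; rewrite eq_complex /=; apply/andP; split; apply/eqP; field.
Qed.

Lemma partial_x_le_grad_norm (R : realType) (n : nat) (f : 'rV[R[i]^o]_n -> R)
    (k : 'I_n) (z : 'rV[R[i]^o]_n) : `|partial_x f k z| <= grad_norm f z.
Proof.
rewrite -sqrtr_sqr /grad_norm; apply: ler_wsqrtr.
have sum_ge (a b : 'I_n -> R) :
    a k ^+ 2 <= \sum_(j < n) a j ^+ 2 + \sum_(j < n) b j ^+ 2.
  rewrite (bigD1 k)//= -addrA lerDl addr_ge0//;
  by apply: sumr_ge0 => j _; exact: sqr_ge0.
exact: (sum_ge (fun j => partial_x f j z) (fun j => partial_y f j z)).
Qed.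

Theorem theorem2p3 (R : realType) (n : nat) (n_ge1 : (1 <= n)%N) :
  (forall f : 'rV[R[i]^o]_n -> R,
     pluriharmonic_on_ball f ->
     (forall z, unit_ball z -> -1 < f z < 1) ->
     forall z, unit_ball z ->
       grad_norm f z <= (4 / pi) * ((1 - `|f z| ^+ 2) / (1 - enorm z ^+ 2)))
  /\
  (forall c : R, c < 4 / pi ->
     ~ (forall f : 'rV[R[i]^o]_n -> R,
          pluriharmonic_on_ball f ->
          (forall z, unit_ball z -> -1 < f z < 1) ->
          forall z, unit_ball z ->
            grad_norm f z <= c * ((1 - `|f z| ^+ 2) / (1 - enorm z ^+ 2)))).
Proof.
split=> [f [F [dF fF]] fI z zB|c c4 hc].
  have z1 : sqnorm z < 1 by exact/unit_ballE.
  rewrite enorm_sqr real_normK ?num_real// mulrA ler_pdivlMr ?subr_gt0//.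
  exact: (grad_norm_le dF fF fI zB).
(* The extremal function depends on the first coordinate only, which exists because [n] is
   positive. *)
pose k : 'I_n := Ordinal n_ge1.
pose F (z : 'rV[R[i]^o]_n) : R[i]^o := strip_map (z 0 k).
pose f z := complex.Re (F z).
have zk (z : 'rV[R[i]^o]_n) : unit_ball z -> normc (z 0 k) < 1.
  move=> /unit_ballE z1; case E : (z 0 k) => [x y] /=.
  rewrite -[X in _ < X]sqrtr1 ltr_sqrt//; apply: le_lt_trans z1.
  rewrite /sqnorm (bigD1 k)//= E /= lerDl.
  by apply: sumr_ge0 => j _; rewrite addr_ge0 ?sqr_ge0.
have fP : pluriharmonic_on_ball f.
  exists F; split=> [z zB|z _]; last by [].
  apply: (@differentiable_comp _ _ _ _ (fun z : 'rV[R[i]^o]_n => z 0 k) (@strip_map R)).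
    exact: differentiable_coord.
  by apply/derivable1_diffP; have [] := is_derive_strip_map (zk z zB).
have sq0 : sqnorm (0 : 'rV[R[i]^o]_n) = 0.
  by apply: big1 => j _; rewrite mxE expr0n addr0.
have B0 : unit_ball (0 : 'rV[R[i]^o]_n) by apply/unit_ballE; rewrite sq0.
(* At the origin both [f] and [enorm] vanish, so [hc] bounds the gradient by [c], whereas its
   component [partial_x f k 0] is [4 / pi]. *)
have := hc f fP (fun z _ => Re_strip_map _) 0 B0.
rewrite enorm_sqr sq0 subr0 divr1 {2}/f /F mxE strip_map0 normr0 expr0n subr0 mulr1.
apply/negP; rewrite -ltNge; apply: (lt_le_trans c4).
have px : partial_x f k 0 = 4 / pi.
  rewrite /partial_x derive1E.
  have := @is_derive_Re_line R (@strip_map R) (4 / pi)%:C 1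
    (fun t => f (0 + (t +i* 0) *: delta_mx 0 k)) 1 (Normc.normc1 R) ltr01 _
    (is_derive_strip_map0 R).
  move=> [|_ ->]; last by rewrite /= mulr0 subr0 mulr1.
  move=> t _; congr (complex.Re (strip_map _)).
  by rewrite !mxE !eqxx add0r.
have p0 : (0 : R) <= 4 / pi by rewrite divr_ge0 ?pi_ge0.
have := partial_x_le_grad_norm f k 0.
by rewrite px ger0_norm.
Qed.
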